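(* Suppose $(\Gamma,\psi)$ is an $H$-asymptotic couple with asymptotic integration and $\Gamma$ is divisible. Let $\Psi=\psi(\Gamma^{\neq})$ and let $B$ be a nonempty downward closed subset of $\Psi$ such that $s(B)\subseteq B$ and $B\neq\Psi$. Then there is a divisible $H$-asymptotic couple $(\Gamma_B,\psi_B)$ extending $(\Gamma,\psi)$ with a family $(\beta_k)_{k\in\mathbb{Z}}$ in $\Psi_B=\psi_B(\Gamma_B^{\neq})$ satisfying the following conditions: (1) $(\Gamma_B,\psi_B)$ has asymptotic integration; (2) $B<\beta_k<\Gamma^{>B}$ and $s(\beta_k)=\beta_{k+1}$ for all $k\in\mathbb{Z}$; (3) for any embedding $i:(\Gamma,\psi)\to(\Gamma^*,\psi^* )$ into a divisible $H$-asymptotic couple with asymptotic integration and any family $(\beta_k^* )_{k\in\mathbb{Z}}$ in $\Psi^*=\psi^*((\Gamma^* )^{\neq})$ such that $i(B)<\beta_k^*<i(\Gamma^{>B})$ and $s(\beta_k^* )=\beta_{k+1}^*$ for all $k\in\mathbb{Z}$, there is a unique extension of $i$ to an embedding $(\Gamma_B,\psi_B)\to(\Gamma^*,\psi^* )$ sending $\beta_k$ to $\beta_k^*$ for all $k\in\mathbb{Z}$.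
   Context: An asymptotic couple is a pair $(\Gamma,\psi)$ where $\Gamma$ is a (totally) ordered abelian group and $\psi:\Gamma^{\neq}\to\Gamma$ (with $\Gamma^{\neq}=\Gamma\setminus\{0\}$) satisfies for all $\alpha,\beta\in\Gamma^{\neq}$: (AC1) $\alpha+\beta\neq0\Rightarrow\psi(\alpha+\beta)\geq\min(\psi(\alpha),\psi(\beta))$; (AC2) $\psi(r\alpha)=\psi(\alpha)$ for all nonzero $r\in\mathbb{Z}$; (AC3) $\alpha>0\Rightarrow\alpha+\psi(\alpha)>\psi(\beta)$. It is $H$-asymptotic (of $H$-type) if moreover $0<\alpha\leq\beta\Rightarrow\psi(\alpha)\geq\psi(\beta)$, and divisible if $\Gamma$ is divisible. Put $\gamma'=\gamma+\psi(\gamma)$ for $\gamma\in\Gamma^{\neq}$. $(\Gamma,\psi)$ has asymptotic integration if $\{\gamma':\gamma\in\Gamma^{\neq}\}=\Gamma$; if it is also of $H$-type, then for each $\alpha\in\Gamma$ there is a unique $\beta\in\Gamma^{\neq}$ with $\beta'=\alpha$, denoted $\int\alpha$, and the successor function is $s(\alpha)=\psi(\int\alpha)$ (in each $H$-asymptotic couple with asymptotic integration, $s$ denotes its own successor function). An embedding $h:(\Gamma,\psi)\to(\Gamma_1,\psi_1)$ is an embedding of ordered abelian groups with $h(\psi(\gamma))=\psi_1(h(\gamma))$ for all $\gamma\in\Gamma^{\neq}$; $(\Gamma_1,\psi_1)$ extends $(\Gamma,\psi)$ if $\Gamma\subseteq\Gamma_1$ and the inclusion is an embedding. For $B\subseteq\Gamma$,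 $\Gamma^{>B}=\{\gamma\in\Gamma:\gamma>b\text{ for all }b\in B\}$; for sets $X,Y$, $X<Y$ means $x<y$ for all $x\in X,y\in Y$ (and $X<\beta$ means $x<\beta$ for all $x\in X$). A subset $B\subseteq\Psi$ is downward closed if $b\in B$, $x\in\Psi$, $x<b$ imply $x\in B$. *)

(* Defs.v *)
From HB Require Import structures.
From mathcomp Require Import all_boot all_order all_algebra.
From mathcomp Require Import boolp classical_sets.

Set Implicit Arguments.
Unset Strict Implicit.
Unset Printing Implicit Defensive.

Import Order.TTheory GRing.Theory Num.Theory.

Local Open Scope classical_set_scope.
Local Open Scope ring_scope.

(* The join of Order.Total and GRing.Zmodule cannot be declared below the
   existing Num.RealDomain, so totality is an axiom over porderZmodType. *)
HB.mixin Record isOrderedZmodule R of Num.POrderedZmodule R := {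
  ozmod_leD2l : forall z x y : R, x <= y -> z + x <= z + y;
  ozmod_le_total : forall x y : R, (x <= y) || (y <= x)
}.

#[short(type="orderedZmodType")]
HB.structure Definition OrderedZmodule :=
  { R of Num.POrderedZmodule R & isOrderedZmodule R }.

Section AsymptoticCouples.
Variable G : orderedZmodType.

Definition divisible := forall (n : nat) (x : G),
  (0 < n)%N -> exists y : G, y *+ n = x.

(* A map from the nonzero elements of G to G is represented by a total function
   psi : G -> G; the value psi 0 is irrelevant: it occurs below only through
   the default value of the integral, in the absence of asymptotic integration.
*)
Variable psi : G -> G.

Record asymptotic_couple : Prop := AsymptoticCouple {
  AC1 : forall a b : G, a != 0 -> b != 0 -> a + b != 0 ->
    Num.min (psi a) (psi b) <= psi (a + b);
  AC2 : forall (a : G) (r : int), a != 0 -> r != 0 -> psi (a *~ r) = psi a;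
  AC3 : forall a b : G, a != 0 -> b != 0 -> 0 < a -> psi b < a + psi a
}.

Record H_asymptotic_couple : Prop := HAsymptoticCouple {
  H_asymptotic_couple_couple :> asymptotic_couple;
  H_type : forall a b : G, 0 < a -> a <= b -> psi b <= psi a
}.

Definition Psi_set : set G := psi @` [set g | g != 0].

Definition asymptotic_integration : Prop :=
  [set g + psi g | g in [set g | g != 0]] = setT.

(* For a couple of H-type with asymptotic integration the set below is a
   singleton; in general, xget chooses an element of it, or 0 if it is empty. *)
Definition integral (a : G) : G :=
  xget 0 [set b | b != 0 /\ b + psi b = a].

Definition succ_fun (a : G) : G := psi (integral a).

End AsymptoticCouples.

Record ac_embedding (G G1 : orderedZmodType) (psi : G -> G) (psi1 : G1 -> G1)
    (h : G -> G1) : Prop := AcEmbedding {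
  ac_embeddingD : {morph h : x y / x + y};
  ac_embedding_le : {mono h : x y / x <= y};
  ac_embedding_psi : forall g : G, g != 0 -> h (psi g) = psi1 (h g)
}.

Definition set_lt (G : orderedZmodType) (X Y : set G) : Prop :=
  forall x y : G, X x -> Y y -> x < y.

Definition strictly_above (G : orderedZmodType) (B : set G) : set G :=
  [set g | forall b, B b -> b < g].

Definition downward_closed_in (G : orderedZmodType) (P B : set G) : Prop :=
  forall b x : G, B b -> P x -> x < b -> B x.

(* Membership of the beta k in Psi1 is not part of this predicate. *)
Definition cut_orbit (G G1 : orderedZmodType) (B : set G) (h : G -> G1)
    (psi1 : G1 -> G1) (beta : int -> G1) : Prop :=
  forall k : int,
    [/\ set_lt (h @` B) [set beta k],
        set_lt [set beta k] (h @` strictly_above B)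
      & succ_fun psi1 (beta k) = beta (k + 1)].

(* Main.v *)
(* Since [B] is not all of [Psi], some [g0] has its successor in [Psi] above [B].
   The successor identity [psi (x - y) = s x] for [s x < s y] forces
   [psi (g0 - beta_k) = beta_(k + 1)], so the positive elements
   [e_k = g0 - beta_k] have pairwise distinct archimedean classes, decreasing
   in [k], which separate the elements of [G] with [psi]-value in [B] from the
   others. Hence order and [psi] on [G + \sum_k rat e_k] are dictated by the
   dominant term of each element; this describes the extension and shows that
   the same formulas hold in every target of the universal property. *)
Require Import Defs.
From HB Require Import structures.
From mathcomp Require Import all_boot all_order all_algebra.
From mathcomp Require Import ring finmap monalg.
From mathcomp Require Import boolp classical_sets.

Set Implicit Arguments.
Unset Strict Implicit.
Unset Printing Implicit Defensive.

Import Order.TTheory GRing.Theory Num.Theory.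

Local Open Scope classical_set_scope.
Local Open Scope ring_scope.

(** * Order arithmetic in ordered abelian groups *)

Section OrderedZmoduleTheory.
Variable G : orderedZmodType.
Implicit Types x y z t : G.

Lemma oz_leD2l z x y : (z + x <= z + y) = (x <= y).
Proof.
apply/idP/idP => [|/ozmod_leD2l]; last exact.
by move=> /(ozmod_leD2l (- z)); rewrite !addKr.
Qed.

Lemma oz_leD2r z x y : (x + z <= y + z) = (x <= y).
Proof. by rewrite ![_ + z]addrC oz_leD2l. Qed.

Lemma oz_ltD2l z x y : (z + x < z + y) = (x < y).
Proof. by rewrite !lt_neqAle oz_leD2l (inj_eq (addrI z)). Qed.

Lemma oz_ltD2r z x y : (x + z < y + z) = (x < y).
Proof. by rewrite ![_ + z]addrC oz_ltD2l. Qed.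

Lemma oz_subr_gt0 x y : (0 < y - x) = (x < y).
Proof. by rewrite -(oz_ltD2r x 0) add0r subrK. Qed.

Lemma oz_subr_ge0 x y : (0 <= y - x) = (x <= y).
Proof. by rewrite -(oz_leD2r x 0) add0r subrK. Qed.

Lemma oz_oppr_gt0 x : (0 < - x) = (x < 0).
Proof. by rewrite -oz_subr_gt0 sub0r. Qed.

Lemma oz_leN2 x y : (- x <= - y) = (y <= x).
Proof. by rewrite -[LHS]oz_subr_ge0 opprK addrC oz_subr_ge0. Qed.

Lemma oz_leNgt x y : (x <= y) = ~~ (y < x).
Proof.
have [xy|] := boolP (x <= y); first by rewrite le_gtF.
have := ozmod_le_total x y => /orP[->//|yx] nxy.
by rewrite lt_neqAle yx andbT; case: eqP nxy => // ->; rewrite lexx.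
Qed.

Lemma oz_ltNge x y : (x < y) = ~~ (y <= x).
Proof. by rewrite oz_leNgt negbK. Qed.

Lemma oz_ltD x y z t : x < y -> z <= t -> x + z < y + t.
Proof.
move=> xy zt; apply: (@le_lt_trans _ _ (x + t));
by rewrite ?oz_leD2l ?oz_ltD2r.
Qed.

Lemma oz_addr_gt0 x y : 0 < x -> 0 < y -> 0 < x + y.
Proof. by move=> x0 /ltW y0; rewrite -[0]addr0; apply: oz_ltD. Qed.

Lemma oz_gt0_or x : x != 0 -> (0 < x) || (0 < - x).
Proof.
rewrite oz_oppr_gt0 => x0; have := ozmod_le_total 0 x.
by rewrite !le_eqVlt eq_sym (negPf x0).
Qed.

Lemma oz_gt0N x : x != 0 -> (0 < - x) = ~~ (0 < x).
Proof. by move=> x0; rewrite oz_oppr_gt0 -oz_leNgt le_eqVlt (negPf x0). Qed.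

Lemma oz_mulrn_gt0 x n : 0 < x -> 0 < x *+ n.+1.
Proof.
move=> x0; elim: n => [|n IHn]; first by rewrite mulr1n.
by rewrite mulrS oz_addr_gt0.
Qed.

Lemma oz_mulrz_gt0 x (n : int) : 0 < n -> 0 < x -> 0 < x *~ n.
Proof. by case: n => [[|n]|n] // _; exact: oz_mulrn_gt0. Qed.

Lemma oz_mulrz_neq0 x (n : int) : n != 0 -> x != 0 -> x *~ n != 0.
Proof.
move=> n0 x0; wlog x_gt0 : x x0 / 0 < x => [hw|].
  have /orP[/hw->//|xN] := oz_gt0_or x0.
  by rewrite -oppr_eq0 -mulNrz hw ?oppr_eq0.
have [nN|nP|n_0] := ltgtP n 0; last by rewrite n_0 in n0.
  by rewrite -oppr_eq0 -mulrNz gt_eqF// oz_mulrz_gt0// oppr_gt0.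
by rewrite gt_eqF// oz_mulrz_gt0.
Qed.

Lemma oz_mulrz_inj (n : int) : n != 0 -> injective (fun x => x *~ n).
Proof.
move=> n0 x y /eqP; rewrite -subr_eq0 -mulrzBl.
by apply: contraTeq; rewrite -subr_eq0 => /(oz_mulrz_neq0 n0).
Qed.

End OrderedZmoduleTheory.

(** * Dominance, integration and the successor function in couples of $H$-type *)

Section HAsymptoticCouples.
Variables (G : orderedZmodType) (psi : G -> G).
Hypothesis Hpsi : H_asymptotic_couple psi.
Implicit Types a b c : G.

Lemma psiN a : psi (- a) = psi a.
Proof.
have [->|a0] := eqVneq a 0; first by rewrite oppr0.
by rewrite -(AC2 Hpsi (r := -1) a0).
Qed.

Definition negligible a b := (b == 0) || (psi a < psi b).

Lemma negligibleN a b : negligible a (- b) = negligible a b.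
Proof. by rewrite /negligible oppr_eq0 psiN. Qed.

Lemma psi_ge_add a b c : c <= psi a -> c <= psi b ->
  a != 0 -> b != 0 -> a + b != 0 -> c <= psi (a + b).
Proof.
move=> ca cb a0 b0 ab0; apply: le_trans (AC1 Hpsi a0 b0 ab0).
by rewrite minEle; case: ifP.
Qed.

Lemma negligibleD a b c :
  negligible a b -> negligible a c -> negligible a (b + c).
Proof.
rewrite /negligible; have [->|b0]/= := eqVneq b 0; first by rewrite add0r.
have [->|c0]/= := eqVneq c 0; first by rewrite addr0 (negPf b0).
have [//|bc0] := eqVneq; move=> ab ac.
apply: lt_le_trans (AC1 Hpsi b0 c0 bc0).
by rewrite minEle; case: ifP.
Qed.

(** [psi] behaves as a valuation. If [psi (a + b)] exceeded [psi a], AC1 for [a = (a + b) - b] would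
    fail; and [0 < x], [x + y <= 0] give [x <= - y], hence [psi y <= psi x]. *)
Lemma psi_negligible a b : a != 0 -> negligible a b ->
  [/\ a + b != 0, psi (a + b) = psi a & (0 < a + b) = (0 < a)].
Proof.
move=> a0 /orP[/eqP->|ab]; first by rewrite addr0.
have [->|b0] := eqVneq b 0; first by rewrite addr0.
have ab0 : a + b != 0.
  by rewrite addr_eq0; apply: contraTneq ab => ->; rewrite psiN ltxx.
split=> //.
  apply/eqP; rewrite eq_le (psi_ge_add _ (ltW ab))// andbT oz_leNgt.
  apply/negP => lt; have := AC1 Hpsi ab0 (b := - b).
  rewrite oppr_eq0 addrK psiN => /(_ b0 a0).
  by rewrite minEle; case: ifP => _; rewrite oz_leNgt ?lt ?ab.
have pos x y : 0 < x -> y != 0 -> psi x < psi y -> 0 < x + y.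
  move=> x0 y0 xy; rewrite -(opprK y) oz_subr_gt0 oz_ltNge; apply/negP.
  by move/(H_type Hpsi x0); rewrite psiN oz_leNgt xy.
have /orP[a_gt0|a_lt0] := oz_gt0_or a0; first by rewrite a_gt0 pos.
have -> : (0 < a) = false by rewrite -[a]opprK oz_gt0N ?a_lt0 ?oppr_eq0.
apply/negbTE; rewrite -oz_gt0N// opprD pos ?oppr_eq0//; by rewrite !psiN.
Qed.

(** With [d = psi b - psi a], AC3 gives [psi b < d + psi d], while [d + psi a = psi b]; hence
    [psi a < psi d]. *)
Lemma negligible_psiB a b : a != 0 -> b != 0 -> psi a < psi b ->
  negligible a (psi a - psi b).
Proof.
move=> a0 b0 ab; rewrite -negligibleN opprB /negligible orbC.
have d0 : 0 < psi b - psi a by rewrite oz_subr_gt0.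
rewrite oz_ltNge; case: (boolP (_ <= _)) => //= le.
have := AC3 Hpsi (negbT (gt_eqF d0)) b0 d0.
by rewrite oz_ltNge -[leRHS](subrK (psi a)) oz_leD2l le.
Qed.

(** For [0 < x < y] with [psi y < psi x], dominance gives [psi (y - x) = psi y], and AC3 at [y - x]
    concludes. Opposite signs need AC3 only; on negative elements [psi] is nondecreasing. *)
Lemma lt_deriv a b : a != 0 -> b != 0 -> a < b -> a + psi a < b + psi b.
Proof.
move=> a0 b0 ab.
have psi_le x y : 0 < x -> x < y -> x + psi x < y + psi y.
  move=> x0 xy; have y0 := lt_trans x0 xy.
  have := H_type Hpsi x0 (ltW xy); rewrite le_eqVlt => /orP[/eqP->|yx].
    by rewrite oz_ltD2r.
  have d0 : 0 < y - x by rewrite oz_subr_gt0.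
  have nx : negligible y (- x) by rewrite negligibleN /negligible yx orbT.
  have [dn0 psid _] := psi_negligible (negbT (gt_eqF y0)) nx.
  have := AC3 Hpsi dn0 (negbT (gt_eqF x0)) d0; rewrite psid => h.
  by rewrite -(oz_ltD2l (- x)) addKr addrA [- x + y]addrC.
have [a_gt0|a_le0] := boolP (0 < a); first exact: psi_le.
have Na_gt0 : 0 < - a by rewrite oz_gt0N.
have [b_gt0|b_le0] := boolP (0 < b).
  apply: lt_trans (AC3 Hpsi b0 a0 b_gt0).
  by rewrite -oz_subr_gt0 opprD addrCA subrr addr0.
apply: oz_ltD => //; rewrite -(psiN a) -(psiN b); apply: H_type => //.
  by rewrite oz_gt0N.
by rewrite oz_leN2 ltW.
Qed.

Lemma deriv_inj a b : a != 0 -> b != 0 -> a + psi a = b + psi b -> a = b.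
Proof.
wlog ab : a b / a < b => [hw a0 b0 E|a0 b0 E]; last first.
  by have := lt_deriv a0 b0 ab; rewrite E ltxx.
have [//|] := eqVneq a b; rewrite -subr_eq0 => /oz_gt0_or.
by rewrite opprB !oz_subr_gt0 => /orP[] /hw h; [apply: esym|]; exact: h.
Qed.

Lemma integral_deriv b : b != 0 -> integral psi (b + psi b) = b.
Proof.
move=> b0; rewrite /integral; case: xgetP => [x _ [x0 xb]|/(_ b)[]//].
exact: deriv_inj.
Qed.

Lemma succ_deriv b : b != 0 -> succ_fun psi (b + psi b) = psi b.
Proof. by move=> b0; rewrite /succ_fun integral_deriv. Qed.

Hypothesis Ipsi : asymptotic_integration psi.

Lemma integralP a :
  integral psi a != 0 /\ integral psi a + succ_fun psi a = a.
Proof.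
have : [set: G] a by []; rewrite -Ipsi => -[b /= b0 <-].
by rewrite /succ_fun integral_deriv.
Qed.

Lemma Psi_succ a : Psi_set psi (succ_fun psi a).
Proof. by exists (integral psi a) => //; case: (integralP a). Qed.

(** After writing [a] and [b] as integral plus successor, the integral of [a] dominates both the
    integral of [b] and the difference of the successors. *)
Lemma psiB_succ a b : succ_fun psi a < succ_fun psi b ->
  [/\ a - b != 0, psi (a - b) = succ_fun psi a
    & (0 < a - b) = (0 < integral psi a)].
Proof.
move=> sab; have [ia0 aE] := integralP a; have [ib0 bE] := integralP b.
have -> : a - b = integral psi a +
    (- integral psi b + (succ_fun psi a - succ_fun psi b)).
  by rewrite addrA addrACA -opprD aE bE.
apply: (psi_negligible ia0); apply: negligibleD; last exact: negligible_psiB.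
by rewrite negligibleN /negligible [psi _ < _]sab orbT.
Qed.

(** For [p = psi g], a positive integral would by AC3 have derivative above [psi g], yet its
    derivative is [p]. *)
Lemma integral_Psi_lt0 p : Psi_set psi p -> integral psi p < 0.
Proof.
case=> g g0 <-{p}; have [i0 ig] := integralP (psi g).
rewrite -oz_oppr_gt0 oz_gt0N//; apply/negP => i_gt0.
by have := AC3 Hpsi i0 g0 i_gt0; rewrite [X in _ < X]ig ltxx.
Qed.

Lemma lt_succ_Psi p : Psi_set psi p -> p < succ_fun psi p.
Proof.
move=> /integral_Psi_lt0 ip; have [_ {1}<-] := integralP p.
by rewrite -[ltRHS]add0r oz_ltD2r.
Qed.

End HAsymptoticCouples.

(* If [b <= a] and [0 < a + b], then [0 < a + b <= a + a]. *)
Lemma AC1_of_H_type (G : orderedZmodType) (psi : G -> G) :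
  (forall a, psi (- a) = psi a) -> (forall a, a != 0 -> psi (a + a) = psi a) ->
  (forall a b, 0 < a -> a <= b -> psi b <= psi a) ->
  forall a b : G, a != 0 -> b != 0 -> a + b != 0 ->
    Num.min (psi a) (psi b) <= psi (a + b).
Proof.
move=> psiN psi2 psi_le a b a0 b0 ab0.
suff: forall c, c <= psi a -> c <= psi b -> c <= psi (a + b).
  by apply; rewrite minEle; case: ifP => // /negbT; rewrite -oz_ltNge => /ltW.
move=> c ca cb; wlog ab_gt0 : a b a0 b0 ab0 ca cb / 0 < a + b => [hw|].
  have /orP[|N_gt0] := oz_gt0_or ab0; first exact: hw.
  by rewrite -psiN opprD hw -?opprD ?oppr_eq0// psiN.
wlog ba : a b a0 b0 ab0 ca cb ab_gt0 / b <= a => [hw|].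
  have /orP[ab|ba] := ozmod_le_total a b; last exact: hw.
  by rewrite addrC hw 1?addrC.
by apply: le_trans ca _; rewrite -[leLHS]psi2// psi_le// oz_leD2l.
Qed.

Lemma morphD_zmod (U V : zmodType) (f : U -> V) :
  {morph f : x y / x + y} -> zmod_morphism f.
Proof. by move=> fD x y; apply: (addIr (f y)); rewrite -fD !subrK. Qed.

Definition additive_of_morphD (U V : zmodType) (f : U -> V)
    (fD : {morph f : x y / x + y}) : {additive U -> V} :=
  HB.pack_for {additive U -> V} f
    (GRing.isZmodMorphism.Build U V f (morphD_zmod fD)).

(** * Rational multiples in a divisible ordered abelian group *)

Section RationalScaling.
Variables (G : orderedZmodType).
Hypothesis Gdiv : divisible G.

(* Torsion-freeness makes the element chosen by [xget] unique. *)
Definition qscale (q : rat) (x : G) : G :=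
  xget 0 [set y | y *~ denq q = x *~ numq q].

Lemma qscaleP q x : qscale q x *~ denq q = x *~ numq q.
Proof.
rewrite /qscale; case: xgetP => [y _ //|].
have [|y yE] := Gdiv (n := `|denq q|%N) (x *~ numq q).
  by rewrite absz_gt0 denq_eq0.
by move=> /(_ y)[] /=; rewrite -yE -[in LHS](gez0_abs (denq_ge0 q)).
Qed.

(** Any fraction [m / n] representing [q] may be used, not only the reduced one. *)
Lemma qscale_eq (q : rat) (m n : int) x y : n != 0 ->
  q * n%:~R = m%:~R -> y *~ n = x *~ m -> qscale q x = y.
Proof.
move=> n0 qE yE; apply: (oz_mulrz_inj (mulf_neq0 (denq_neq0 q) n0)).
rewrite mulrzA qscaleP [denq q * n]mulrC mulrzA yE -!mulrzA; congr (x *~ _).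
apply: (intr_inj (R := rat)); rewrite !intrM -qE mulrC [RHS]mulrC mulrA.
by rewrite [_ * q]mulrC -numqE mulrC.
Qed.

Lemma qscaleDl p q x : qscale (p + q) x = qscale p x + qscale q x.
Proof.
apply: (@qscale_eq _ (numq p * denq q + numq q * denq p) (denq p * denq q)).
- by rewrite mulf_neq0 ?denq_neq0.
- by rewrite intrD !intrM !numqE; ring.
rewrite mulrzDl mulrzA qscaleP [X in _ + _ *~ X]mulrC mulrzA qscaleP.
by rewrite -!mulrzA mulrzDr.
Qed.

Lemma qscaleN q x : qscale (- q) x = - qscale q x.
Proof.
apply: (@qscale_eq _ (- numq q) (denq q)); rewrite ?denq_neq0//.
  by rewrite mulNr -numqE rmorphN.
by rewrite mulNrz qscaleP mulrNz.
Qed.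

Lemma qscale0 x : qscale 0 x = 0.
Proof. by apply: (@qscale_eq _ 0 1); rewrite ?mul0r// mul0rz. Qed.

Lemma qscale1 x : qscale 1 x = x.
Proof. exact: (@qscale_eq _ 1 1). Qed.

Lemma qscale_neq0 q x : q != 0 -> x != 0 -> qscale q x != 0.
Proof.
move=> q0 x0; have : qscale q x *~ denq q != 0.
  by rewrite qscaleP oz_mulrz_neq0// numq_eq0.
by apply: contraNneq => ->; rewrite mul0rz.
Qed.

Lemma qscale_gt0 q x : 0 < q -> 0 < x -> 0 < qscale q x.
Proof.
move=> q0 x0.
have : 0 < qscale q x *~ denq q by rewrite qscaleP oz_mulrz_gt0// numq_gt0.
have y0 : qscale q x != 0 by rewrite qscale_neq0// gt_eqF.
apply: contraTT; rewrite -!oz_gt0N ?oz_mulrz_neq0 ?denq_neq0//.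
by rewrite -mulNrz; apply: oz_mulrz_gt0.
Qed.

Lemma qscale_gt0E q x : q != 0 -> 0 < x -> (0 < qscale q x) = (0 < q).
Proof.
move=> q0 x0; have [|qN|qE] := ltgtP 0 q; first by move/qscale_gt0; apply.
  have y0 : qscale q x != 0 by rewrite qscale_neq0// gt_eqF.
  by apply/negbTE; rewrite -oz_gt0N// -qscaleN qscale_gt0// oppr_gt0.
by rewrite -qE eqxx in q0.
Qed.

Lemma psi_qscale (psi : G -> G) q x : H_asymptotic_couple psi ->
  q != 0 -> x != 0 -> psi (qscale q x) = psi x.
Proof.
move=> Hpsi q0 x0; rewrite -(AC2 Hpsi (r := denq q)) ?qscale_neq0//.
by rewrite qscaleP (AC2 Hpsi) ?numq_eq0.
Qed.

Lemma additive_qscale (H : zmodType) (h : {additive H -> G}) q x y :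
  y *~ denq q = x *~ numq q -> h y = qscale q (h x).
Proof.
move=> yE; apply/esym/(@qscale_eq _ (numq q) (denq q)).
- exact: denq_neq0.
- by rewrite -numqE.
- by rewrite -!raddfMz yE.
Qed.

End RationalScaling.

(** * Leading indices and signs of finitely supported rational vectors *)

Section LexicographicVectors.
Implicit Types (v w : {malg rat[int]}) (m n : int).

(* The lexicographic order on [{malg rat[int]}] is decided by the coefficient of
   smallest index; [low 0 = 0] is a junk value. *)
Definition low v : int :=
  xget 0 [set m | v@_m != 0 /\ forall j, j < m -> v@_j = 0].

Definition vpos v := 0 < v@_(low v).

Lemma low_eq v m : v@_m != 0 -> (forall j, j < m -> v@_j = 0) -> low v = m.
Proof.
move=> vm vj; rewrite /low; case: xgetP => [n _ [vn vnj]|/(_ m)[]//].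
by have [/vj/eqP|/vnj/eqP|//] := ltgtP n m; rewrite ?(negPf vn) ?(negPf vm).
Qed.

(** The support is finite and nonempty, so it has a least element ([min_ex]), which lies in the set
    defining [low]. *)
Lemma lowP v : v != 0 -> v@_(low v) != 0 /\ forall j, j < low v -> v@_j = 0.
Proof.
move=> v0; rewrite /low; case: xgetP => [n _ //|no].
have [s0|] := eqVneq (msupp v) fset0.
  by case/eqP: v0; apply/malgP => k; rewrite mcoeff0 mcoeff_outdom ?s0.
have min_ex (s : seq int) x : exists2 m, m \in x :: s & all (>= m) (x :: s).
  elim: s x => [|y s IHs] x; first by exists x; rewrite ?inE//= lexx.
  have [m ms ma] := IHs y; have [xm|mx] := leP x m.
    exists x; rewrite ?inE ?eqxx//=; rewrite lexx/=.
    by apply: sub_all ma => z; apply: le_trans.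
  by exists m; [rewrite inE ms orbT|rewrite /= ltW].
case/fset0Pn => x; case E : (enum_fset (msupp v)) => [|y s].
  by rewrite -topredE /= /pred_of_finset E.
have [m ms /allP ma] := min_ex s y; rewrite -E in ms ma.
move=> _; case: (no m); split; first by rewrite mcoeff_neq0.
move=> j jm; apply/eqP; rewrite mcoeff_eq0; apply/negP => /ma.
by rewrite leNgt jm.
Qed.

Lemma vpos0 : vpos 0 = false. Proof. by rewrite /vpos mcoeff0 ltxx. Qed.

Lemma vpos_neq0 v : vpos v -> v != 0.
Proof. by apply: contraTneq => ->; rewrite vpos0. Qed.

Lemma mcoeffMz v (r : int) k : (v *~ r)@_k = v@_k * r%:~R.
Proof. by rewrite raddfMz -mulrzr. Qed.

Lemma mulvz_eq0 v (r : int) : r != 0 -> (v *~ r == 0) = (v == 0).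
Proof.
move=> r0; apply/eqP/eqP => [/malgP h|->]; last by rewrite mul0rz.
apply/malgP => k; move/eqP: (h k); rewrite mcoeffMz mcoeff0.
by rewrite mulf_eq0 intr_eq0 (negPf r0) orbF => /eqP.
Qed.

Lemma lowMz v (r : int) : r != 0 -> low (v *~ r) = low v.
Proof.
move=> r0; congr (xget 0 _); apply/funext => m; apply/propext.
have E0 j : ((v *~ r)@_j == 0) = (v@_j == 0).
  by rewrite mcoeffMz mulf_eq0 intr_eq0 (negPf r0) orbF.
rewrite /= E0; split=> -[-> h]; split=> // j /h.
  by move/eqP; rewrite E0 => /eqP.
by move=> hj; apply/eqP; rewrite E0 hj.
Qed.

Lemma lowN v : low (- v) = low v.
Proof. by rewrite -[- v]/(v *~ -1) lowMz. Qed.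

Lemma vposN v : v != 0 -> vpos (- v) = ~~ vpos v.
Proof.
move=> /lowP[v0 _]; rewrite /vpos lowN mcoeffN oppr_gt0.
by rewrite -leNgt le_eqVlt (negPf v0).
Qed.

(** Without cancellation at [low v], that index stays the leading one. The guard [w != 0] avoids the
    junk value [low 0]. *)
Lemma low_vposD v w : v != 0 -> (w != 0 -> low v <= low w) ->
  v@_(low v) + w@_(low v) != 0 ->
  low (v + w) = low v /\ vpos (v + w) = (0 < v@_(low v) + w@_(low v)).
Proof.
move=> /lowP[v0 vj] vw s0; rewrite /vpos; have -> : low (v + w) = low v.
  apply: low_eq => [|j jv]; rewrite mcoeffD// vj// add0r.
  have [->|w0] := eqVneq w 0; first by rewrite mcoeff0.
  by have [_ ->//] := lowP w0; apply: lt_le_trans jv (vw w0).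
by rewrite mcoeffD.
Qed.

Lemma vposD v w : vpos v -> vpos w -> vpos (v + w).
Proof.
move=> vp wp; wlog vw : v w vp wp / low v <= low w => [hw|].
  by have [/hw|/ltW/hw] := leP (low v) (low w); rewrite 1?addrC; exact.
have w_ge0 : 0 <= w@_(low v).
  move: vw; rewrite le_eqVlt => /orP[/eqP->|]; first exact: ltW.
  by have [_ h] := lowP (vpos_neq0 wp) => /h->.
have s0 : 0 < v@_(low v) + w@_(low v) by rewrite ltr_pwDl.
have [|_ ->//] := low_vposD (vpos_neq0 vp) (fun _ => vw).
by rewrite gt_eqF.
Qed.

Lemma mcoeff_vec k j : (<< k >> : {malg rat[int]})@_j = (k == j)%:R.
Proof. exact: mcoeffU. Qed.

Lemma mkmalgU_mulz (q : rat) (d n k : int) : q * d%:~R = n%:~R ->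
  << q *g k >> *~ d = << k >> *~ n :> {malg rat[int]}.
Proof.
move=> qE; apply/malgP => j; rewrite !mcoeffMz !mcoeffU.
case: (k == j); last by rewrite !mul0r.
by rewrite !mulr1n mul1r.
Qed.

Lemma low_vec k : low << k >> = k.
Proof.
apply: low_eq => [|j jk]; rewrite mcoeff_vec ?eqxx//.
by rewrite gt_eqF.
Qed.

Lemma vpos_vec k : vpos << k >>.
Proof. by rewrite /vpos low_vec mcoeff_vec eqxx. Qed.

Lemma low_addvec v k : v != 0 -> low v < k -> low (v + << k >>) = low v.
Proof.
move=> v0 vk; have [vl _] := lowP v0.
have E : << k >>@_(low v) = 0 :> rat by rewrite mcoeff_vec gt_eqF.
have [||->//] := @low_vposD v << k >> v0; rewrite ?E ?addr0//.
by rewrite low_vec ltW.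
Qed.

Lemma low_lt_vposB v w : vpos v -> (w != 0 -> low v < low w) -> vpos (v - w).
Proof.
move=> vp vw; have v0 := vpos_neq0 vp; have [vl _] := lowP v0.
have E : (- w)@_(low v) = 0.
  have [->|w0] := eqVneq w 0; first by rewrite oppr0 mcoeff0.
  by have [_ h] := lowP w0; rewrite mcoeffN h ?oppr0// vw.
have [||_ ->] := @low_vposD v (- w) v0; rewrite ?E ?addr0//.
by rewrite oppr_eq0 lowN => /vw/ltW.
Qed.

End LexicographicVectors.

(** * Ordered abelian groups from positive cones *)

Section PositiveCones.

Record is_cone (T : zmodType) (pos : T -> bool) : Prop := IsCone {
  cone0 : pos 0 = false;
  coneD : forall x y, pos x -> pos y -> pos (x + y);
  cone_total : forall x, x != 0 -> pos x || pos (- x)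
}.

(* The unused argument makes the order instance below inferable from the type. *)
Definition cone_group (T : zmodType) (pos : T -> bool) (_ : is_cone pos) :
  Type := T.

Variables (T : zmodType) (pos : T -> bool) (hpos : is_cone pos).

HB.instance Definition _ := GRing.Zmodule.on (cone_group hpos).

Implicit Types x y z : cone_group hpos.
Definition cone_lt x y := pos (y - x).
Definition cone_le x y := (x == y) || pos (y - x).

Fact cone_lt_def x y : cone_lt x y = (y != x) && cone_le x y.
Proof.
rewrite /cone_lt /cone_le eq_sym; case: eqP => //= ->.
by rewrite subrr (cone0 hpos).
Qed.

Fact cone_le_refl : reflexive cone_le.
Proof. by move=> x; rewrite /cone_le eqxx. Qed.

Fact cone_le_anti : antisymmetric cone_le.
Proof.
move=> x y /andP[]; rewrite /cone_le [y == x]eq_sym.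
case: eqP => //= _ p1 p2; have := coneD hpos p1 p2.
by rewrite addrA subrK subrr (cone0 hpos).
Qed.

Fact cone_le_trans : transitive cone_le.
Proof.
move=> y x z; rewrite /cone_le; have [->//|xy/= p1] := eqVneq x y.
have [<-|yz/= p2] := eqVneq y z; first by rewrite p1 orbT.
by have := coneD hpos p2 p1; rewrite addrA subrK => ->; rewrite orbT.
Qed.

HB.instance Definition _ := Order.isPOrder.Build ring_display
  (cone_group hpos) cone_lt_def cone_le_refl cone_le_anti cone_le_trans.

Fact cone_leD2l (z x y : cone_group hpos) : x <= y -> z + x <= z + y.
Proof.
rewrite /Order.le /= /cone_le => /orP[/eqP->|p]; first by rewrite eqxx.
by rewrite opprD addrACA subrr add0r p orbT.
Qed.

Fact cone_le_total (x y : cone_group hpos) : (x <= y) || (y <= x).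
Proof.
rewrite /Order.le /= /cone_le; have [//|xy /=] := eqVneq x y.
by rewrite orbC -[y - x]opprB (cone_total hpos)// subr_eq0.
Qed.

HB.instance Definition _ := isOrderedZmodule.Build (cone_group hpos)
  cone_leD2l cone_le_total.

Lemma cone_ltE x y : (x < y) = pos (y - x).
Proof. by []. Qed.

End PositiveCones.

(** * The cut that [B] makes in [G] *)

Section Extension.
Variables (G : orderedZmodType) (psi : G -> G) (B : set G) (g0 : G).
Hypothesis Hpsi : H_asymptotic_couple psi.
Hypothesis Ipsi : asymptotic_integration psi.
Hypothesis BPsi : B `<=` Psi_set psi.
Hypothesis Bdown : downward_closed_in (Psi_set psi) B.
Hypothesis Bsucc : succ_fun psi @` B `<=` B.
Hypothesis g0_succ : ~ B (succ_fun psi g0).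
Implicit Types (a b c : G) (v w u : {malg rat[int]}).

Let s := succ_fun psi.

(** As [psi] is nonincreasing on positive elements and [B] is downward closed, the elements that are
    not [big] form a convex subgroup; the new elements are inserted just above it. *)
Definition big a := (a != 0) && `[< B (psi a) >].

Lemma B_le p b : Psi_set psi p -> B b -> p <= b -> B p.
Proof.
by move=> Pp Bb; rewrite le_eqVlt => /orP[/eqP->//|]; apply: Bdown Bb Pp.
Qed.

Lemma Psi_psi a : a != 0 -> Psi_set psi (psi a).
Proof. by exists a. Qed.

Lemma nB_gt p b : Psi_set psi p -> ~ B p -> B b -> b < p.
Proof.
by move=> Pp nBp Bb; rewrite oz_ltNge; apply/negP => /(B_le Pp Bb).
Qed.

Lemma big0 : big 0 = false. Proof. by rewrite /big eqxx. Qed.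

Lemma bigN a : big (- a) = big a.
Proof. by rewrite /big oppr_eq0 psiN. Qed.

Lemma bigMz a (r : int) : r != 0 -> big (a *~ r) = big a.
Proof.
move=> r0; have [->|a0] := eqVneq a 0; first by rewrite mul0rz.
by rewrite /big (AC2 Hpsi)// a0 oz_mulrz_neq0.
Qed.

Lemma big_le a b : 0 < a -> a <= b -> big a -> big b.
Proof.
move=> a0 ab /andP[_ /asboolP Ba]; have b0 := lt_le_trans a0 ab.
apply/andP; rewrite gt_eqF//; split=> //; apply/asboolP.
by apply: B_le Ba (H_type Hpsi a0 ab); apply: Psi_psi; rewrite gt_eqF.
Qed.

Lemma smallD a b : ~~ big a -> ~~ big b -> ~~ big (a + b).
Proof.
have [->|a0] := eqVneq a 0; first by rewrite add0r.
have [->|b0] := eqVneq b 0; first by rewrite addr0.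
rewrite /big a0 b0 /= => /asboolP nBa /asboolP nBb.
apply/negP => /andP[ab0 /asboolP Bab].
have := AC1 Hpsi a0 b0 ab0; rewrite minEle; case: ifP => _ /(B_le _ Bab) h.
  by apply/nBa/h/Psi_psi.
by apply/nBb/h/Psi_psi.
Qed.

Lemma small_negligible a b : big a -> ~~ big b -> negligible psi a b.
Proof.
move=> /andP[a0 /asboolP Ba]; rewrite /big /negligible.
have [->//|b0 /= /asboolP nBb] := eqVneq b 0.
by apply: nB_gt => //; apply: Psi_psi.
Qed.

Lemma bigD_small a b : big a -> ~~ big b ->
  [/\ big (a + b), psi (a + b) = psi a & (0 < a + b) = (0 < a)].
Proof.
move=> ba sb; have /andP[a0 Ba] := ba.
have [ab0 pab pos] := psi_negligible Hpsi a0 (small_negligible ba sb).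
by split; rewrite // /big ab0 pab.
Qed.

Lemma succ_nB p : Psi_set psi p -> ~ B p -> ~ B (s p).
Proof.
by move=> Pp nBp /(B_le Pp) h; apply/nBp/h/ltW/lt_succ_Psi.
Qed.

Lemma big_succB a b : B (s a) -> ~ B (s b) ->
  [/\ big (a - b), psi (a - b) = s a & (0 < a - b) = (0 < integral psi a)].
Proof.
move=> Ba nBb; have := nB_gt (Psi_succ Hpsi Ipsi b) nBb Ba.
move=> /(psiB_succ Hpsi Ipsi)[ab0 pab pos].
by split=> //; rewrite /big ab0 pab; apply/asboolP.
Qed.

(** If the successors differ, the successor identity gives [a - b] the smaller one as [psi]-value.
    If they agree, [a - b] is a difference of two integrals, neither of them big. *)
Lemma small_succB a b : ~ B (s a) -> ~ B (s b) -> ~~ big (a - b).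
Proof.
move=> nBa nBb.
have lt x y : ~ B (s x) -> s x < s y -> ~~ big (x - y).
  move=> nBx /(psiB_succ Hpsi Ipsi)[xy0 pxy _].
  by rewrite /big xy0 pxy /=; apply/asboolP.
have [ab|] := boolP (s a < s b); first exact: lt.
rewrite -oz_leNgt le_eqVlt => /orP[/eqP ab|]; last first.
  by rewrite -bigN opprB; apply: lt.
have [ia aE] := integralP Hpsi Ipsi a; have [ib bE] := integralP Hpsi Ipsi b.
have -> : a - b = integral psi a - integral psi b.
  by rewrite -{1}aE -{1}bE -/(s a) -/(s b) ab opprD addrACA subrr addr0.
by apply: smallD; rewrite ?bigN /big ?ia ?ib; apply/asboolP.
Qed.

(** As [s b] is in [B] and [s g0] is not, [b - g0] has the sign of the integral of [b], which is
    negative since [b] is in [Psi]. *)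
Lemma g0B_gt b : B b -> big (g0 - b) /\ 0 < g0 - b.
Proof.
move=> Bb; have Bsb : B (s b) by apply: Bsucc; exists b.
have [bg0 _ pos] := big_succB Bsb g0_succ.
rewrite -bigN opprB; split=> //; rewrite -opprB oz_gt0N ?pos; last first.
  by case/andP: bg0.
by rewrite -oz_leNgt ltW// integral_Psi_lt0//; apply: BPsi.
Qed.

(* [(a, v)] stands for [a + \sum_k v_k (g0 - beta_k)]. The element
   [g0 - beta_k] lies archimedeanly below every [a] with [psi a] in [B], above
   every other [a], and above [g0 - beta_(k + 1)]. *)
Definition ext_pos (x : G * {malg rat[int]}) : bool :=
  if big x.1 then 0 < x.1 else if x.2 != 0 then vpos x.2 else 0 < x.1.

Lemma ext_pos_big a v : big a -> ext_pos (a, v) = (0 < a).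
Proof. by rewrite /ext_pos /= => ->. Qed.

Lemma ext_pos_small a v : ~~ big a -> v != 0 -> ext_pos (a, v) = vpos v.
Proof. by rewrite /ext_pos /= => /negPf-> ->. Qed.

Lemma ext_pos_vpos a v : ~~ big a -> vpos v -> ext_pos (a, v).
Proof. by move=> sa vp; rewrite ext_pos_small ?vpos_neq0. Qed.

Lemma ext_pos0 a : ext_pos (a, 0) = (0 < a).
Proof. by rewrite /ext_pos /= eqxx if_same. Qed.

Lemma ext_cone : is_cone ext_pos.
Proof.
split=> [|[a v] [b w]|[a v]].
- by rewrite (ext_pos0 0) ltxx.
- change ((a, v) + (b, w)) with (a + b, v + w).
  have [ba|sa] := boolP (big a); have [bb|sb] := boolP (big b).
  + rewrite !(@ext_pos_big a, @ext_pos_big b)// => a0 b0.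
    have bab : big (a + b).
      by apply: big_le ba => //; rewrite -[leLHS]addr0 oz_leD2l ltW.
    by rewrite ext_pos_big// oz_addr_gt0.
  + have [bab _ pab] := bigD_small ba sb.
    by rewrite (@ext_pos_big a)// (@ext_pos_big (a + b))// pab.
  + have [] := bigD_small bb sa; rewrite [b + a]addrC => bab _ pab.
    by rewrite (@ext_pos_big b)// (@ext_pos_big (a + b))// pab.
  have sab := smallD sa sb.
  have [->|v0] := eqVneq v 0; have [->|w0] := eqVneq w 0.
  + by rewrite addr0 !ext_pos0; exact: oz_addr_gt0.
  + by rewrite add0r (@ext_pos_small b)// (@ext_pos_small (a + b)).
  + by rewrite addr0 (@ext_pos_small a)// (@ext_pos_small (a + b)).
  rewrite (@ext_pos_small a)// (@ext_pos_small b)// => vp wp.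
  by rewrite ext_pos_vpos ?vposD.
change (- (a, v)) with (- a, - v) => x0.
have [ba|sa] := boolP (big a).
  by rewrite !ext_pos_big ?bigN// oz_gt0_or//; case/andP: ba.
have [v0|v0] := eqVneq v 0.
  rewrite v0 oppr0 !ext_pos0 oz_gt0_or//.
  by apply: contraNneq x0 => ->; rewrite v0.
by rewrite !ext_pos_small ?bigN ?oppr_eq0// vposN// orbN.
Qed.

(** * The order, [psi] and the new elements of the extension *)

Definition ext : orderedZmodType := cone_group ext_cone.

Definition ext_beta (k : int) : ext := (g0, - << k >>).

(** The value of the dominant term, where [e_k = (0, << k >>)] must have value [ext_beta (k + 1)] by
    the successor identity. *)
Definition ext_psi (x : ext) : ext :=
  if big x.1 then (psi x.1, 0)
  else if x.2 != 0 then ext_beta (low x.2 + 1) else (psi x.1, 0).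

Definition ext_inj a : ext := (a, 0).

Lemma ext_ltE (x y : ext) : (x < y) = ext_pos (y.1 - x.1, y.2 - x.2).
Proof. by []. Qed.

Lemma ext_gt0E (x : ext) : (0 < x) = ext_pos x.
Proof. by rewrite cone_ltE subr0. Qed.

Lemma ext_psi_big (x : ext) : big x.1 -> ext_psi x = ext_inj (psi x.1).
Proof. by rewrite /ext_psi => ->. Qed.

Lemma ext_psi_small a v : ~~ big a -> v != 0 ->
  ext_psi (a, v) = ext_beta (low v + 1).
Proof. by rewrite /ext_psi /= => /negPf-> ->. Qed.

Lemma ext_psi_inj a : ext_psi (ext_inj a) = ext_inj (psi a).
Proof. by rewrite /ext_psi /= eqxx if_same. Qed.

Lemma ext_inj_lt a b : (ext_inj a < ext_inj b) = (a < b).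
Proof. by rewrite ext_ltE subrr ext_pos0 oz_subr_gt0. Qed.

Lemma ext_inj_le a b : (ext_inj a <= ext_inj b) = (a <= b).
Proof. by rewrite !oz_leNgt ext_inj_lt. Qed.

Lemma ext_inj_lt_beta b k : B b -> ext_inj b < ext_beta k.
Proof. by move=> /g0B_gt[bb pb]; rewrite ext_ltE ext_pos_big. Qed.

Lemma ext_beta_lt_inj p k : Psi_set psi p -> ~ B p -> ext_beta k < ext_inj p.
Proof.
move=> Pp nBp; rewrite ext_ltE sub0r opprK ext_pos_vpos ?vpos_vec//.
by apply: small_succB => //; apply: succ_nB.
Qed.

Lemma ext_beta_lt k l : k < l -> ext_beta k < ext_beta l.
Proof.
move=> kl; rewrite ext_ltE subrr opprK addrC ext_pos_vpos ?big0//.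
by apply: low_lt_vposB; rewrite ?vpos_vec// !low_vec.
Qed.

Lemma ext_beta_le k l : k <= l -> ext_beta k <= ext_beta l.
Proof. by rewrite le_eqVlt => /orP[/eqP->//|/ext_beta_lt/ltW]. Qed.

(** * The axioms of an $H$-asymptotic couple for the extension *)

Lemma small_psi a : a != 0 -> ~~ big a -> ~ B (psi a).
Proof. by rewrite /big => -> /= /asboolP. Qed.

(** Dominant terms come in three sizes: big in [G], some [e_k], small in [G]. Their values lie in
    [B], among the [ext_beta], and in [Psi] above [B], so they grow as the size drops. *)
Lemma ext_H_type (x y : ext) : 0 < x -> x <= y -> ext_psi y <= ext_psi x.
Proof.
move=> x_gt0; rewrite le_eqVlt => /orP[/eqP->//|xy].
have y_gt0 := lt_trans x_gt0 xy.
move: x_gt0 xy y_gt0; rewrite !ext_gt0E ext_ltE.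
case: x => a v; case: y => b w /=.
have [bb|sb] := boolP (big b).
  rewrite [ext_psi (b, w)]ext_psi_big// [ext_pos (b, w)]ext_pos_big//=.
  move=> x0 xy b0; have Bb : B (psi b) by case/andP: bb => _ /asboolP.
  have [ba|sa] := boolP (big a).
    rewrite ext_psi_big//= ext_inj_le; move: x0; rewrite ext_pos_big// => a0.
    (* If [b - a] is big, [x < y] forces [a < b]; otherwise [psi a = psi b]. *)
    have [bab|sab] := boolP (big (b - a)).
      apply: H_type => //; move: xy.
      by rewrite ext_pos_big// oz_subr_gt0 => /ltW.
    by have [_] := bigD_small ba sab; rewrite addrC subrK => ->.
  have [v0|v0] := eqVneq v 0; last first.
    by rewrite [ext_psi (a, v)]ext_psi_small//= ltW// ext_inj_lt_beta.
  have a0 : a != 0 by apply: contraTneq x0 => ->; rewrite v0 ext_pos0 ltxx.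
  rewrite v0 -/(ext_inj a) ext_psi_inj ext_inj_le ltW//.
  by apply: nB_gt => //; [apply: Psi_psi|apply: small_psi].
have [ba|sa] := boolP (big a).
  (* Here [- a] dominates [y - x], so [x] and [y - x] cannot both be positive. *)
  have Nba : big (- a) by rewrite bigN.
  have [bba _ pba] := bigD_small Nba sb; rewrite addrC in bba pba.
  rewrite (@ext_pos_big a)// (@ext_pos_big (b - a))// pba.
  by rewrite oz_gt0N => [->//|]; case/andP: ba.
have sba : ~~ big (b - a) by rewrite smallD ?bigN.
have [w0|w0] := eqVneq w 0.
  rewrite w0 -/(ext_inj b) ext_psi_inj sub0r ext_pos0.
  have [v0|v0] := eqVneq v 0.
    rewrite v0 oppr0 !ext_pos0 -/(ext_inj a) ext_psi_inj ext_inj_le.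
    by rewrite oz_subr_gt0 => a0 /ltW ab _; apply: H_type.
  by rewrite !ext_pos_small ?oppr_eq0// vposN// => ->.
rewrite [ext_psi (b, w)]ext_psi_small// [ext_pos (b, w)]ext_pos_small//=.
have [v0|v0] := eqVneq v 0.
  move=> x0 _ _; have a0 : a != 0.
    by apply: contraTneq x0 => ->; rewrite v0 ext_pos0 ltxx.
  rewrite v0 -/(ext_inj a) ext_psi_inj ltW//.
  by apply: ext_beta_lt_inj; [apply: Psi_psi|apply: small_psi].
rewrite ext_psi_small//= (@ext_pos_small a)// => vp xy wp; apply: ext_beta_le.
(* [low v < low w] would make [v - w], and with it [x - y], positive. *)
rewrite lerD2r leNgt; apply/negP => vw.
have vwp : vpos (v - w) by apply: low_lt_vposB.
have vw0 := vpos_neq0 vwp.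
by move: xy; rewrite -[w - v]opprB ext_pos_small ?oppr_eq0// vposN ?vwp.
Qed.

Lemma ext_mulzE (x : ext) (r : int) :
  (x *~ r).1 = x.1 *~ r /\ (x *~ r).2 = x.2 *~ r.
Proof.
split; [exact: (raddfMz (fst : G * {malg rat[int]} -> G))|].
exact: (raddfMz (snd : G * {malg rat[int]} -> _)).
Qed.

Lemma ext_AC2 (x : ext) (r : int) : r != 0 -> ext_psi (x *~ r) = ext_psi x.
Proof.
move=> r0; have [E1 E2] := ext_mulzE x r.
rewrite /ext_psi E1 E2 bigMz// mulvz_eq0// lowMz//.
have [x0|x0] := eqVneq x.1 0; first by rewrite x0 mul0rz.
by rewrite (AC2 Hpsi).
Qed.

Lemma ext_neq0 a v : v != 0 -> (a, v) != 0 :> ext.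
Proof. by apply: contra => /eqP[_ ->]. Qed.

Lemma ext_AC3 (x y : ext) : y != 0 -> 0 < x -> ext_psi y < x + ext_psi x.
Proof.
move=> y0; rewrite ext_gt0E ext_ltE; case: x => a v.
have y1 : y.2 = 0 -> y.1 != 0.
  by move=> y2; apply: contraNneq y0; case: y y2 => b w /= -> ->.
have psi_y : [\/ exists2 b, b != 0 & ext_psi y = ext_inj (psi b)
               | exists k, ext_psi y = ext_beta k].
  have [by1|sy] := boolP (big y.1).
    by left; exists y.1; [case/andP: by1|apply: ext_psi_big].
  have [y2|y2] := eqVneq y.2 0; last first.
    by right; case: y sy y2 {y0 y1} => b w; eexists; apply: ext_psi_small.
  by left; exists y.1; [exact: y1|rewrite /ext_psi y2 eqxx if_same].
have [ba|sa] := boolP (big a).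
  rewrite [ext_psi (a, v)]ext_psi_big// ext_pos_big//= addr0 => a_gt0.
  have /andP[a0 /asboolP Ba] := ba.
  case: psi_y => [[b b0 ->]|[k ->]] /=.
    have d_gt0 : 0 < a + psi a - psi b.
      by rewrite oz_subr_gt0; apply: (AC3 Hpsi).
    rewrite subr0; have Pb := Psi_psi b0.
    (* Positivity of this component does not suffice: were it not big, a nonzero [v] would decide
       the sign. *)
    rewrite (@ext_pos_big (a + psi a - psi b))//.
    (* With [c < 0] the integral of [psi b], the component is [(a - c) + (psi a - psi c)], where
       [a - c >= a] is big and the other term is negligible against it. *)
    have [c0 cE] := integralP Hpsi Ipsi (psi b).
    have c_lt0 := integral_Psi_lt0 Hpsi Ipsi Pb.
    move: c0 cE c_lt0; rewrite /succ_fun; move: (integral _ _) => c c0 cE c_lt0.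
    have Nc0 : 0 < - c by rewrite oz_oppr_gt0.
    have le_a : a <= a - c by rewrite -[leLHS]addr0 oz_leD2l ltW.
    have le_c : - c <= a - c by rewrite -[leLHS]add0r oz_leD2r ltW.
    have bac := big_le a_gt0 le_a ba; have /andP[ac0 _] := bac.
    have -> : a + psi a - psi b = (a - c) + (psi a - psi c).
      by rewrite -[in LHS]cE opprD addrACA.
    suff /(psi_negligible Hpsi ac0)[n0 pE _] :
        negligible psi (a - c) (psi a - psi c).
      by rewrite /big n0 pE; case/andP: bac.
    have h1 := H_type Hpsi a_gt0 le_a; have h2 := H_type Hpsi Nc0 le_c.
    rewrite (psiN Hpsi) in h2.
    have [->|ac] := eqVneq (psi a) (psi c).
      by rewrite /negligible subrr eqxx.
    have [lt|] := boolP (psi a < psi c).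
      have /orP[/eqP->|lt'] := negligible_psiB Hpsi a0 c0 lt.
        by rewrite /negligible eqxx.
      by rewrite /negligible (le_lt_trans h1 lt') orbT.
    rewrite -oz_leNgt le_eqVlt eq_sym (negPf ac) /= => lt.
    have := negligible_psiB Hpsi c0 a0 lt.
    rewrite -(negligibleN Hpsi) opprB /negligible => /orP[->//|lt'].
    by rewrite (le_lt_trans h2 lt') orbT.
  (* The integral of [a + psi a] is [a], so [a + psi a - g0] is big and has the sign of [a]. *)
  have [] := @big_succB (a + psi a) g0 _ g0_succ.
    by rewrite /s succ_deriv.
  by rewrite integral_deriv// => bd _ pd; rewrite ext_pos_big// pd.
have [v0|v0] := eqVneq v 0.
  rewrite v0 ext_pos0 -/(ext_inj a) ext_psi_inj /= addr0 => a_gt0.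
  have a0 : a != 0 by rewrite gt_eqF.
  case: psi_y => [[b b0 ->]|[k ->]] /=.
    by rewrite subr0 ext_pos0 oz_subr_gt0; apply: (AC3 Hpsi).
  rewrite sub0r opprK ext_pos_vpos ?vpos_vec//.
  by apply: small_succB => //; rewrite /s succ_deriv//; apply: small_psi.
rewrite ext_pos_small// ext_psi_small//= => vp.
(* Adding [ext_psi x] subtracts a generator of index above [low v], which leaves the leading term
   intact. *)
have vpm : vpos (v - << low v + 1 >>).
  by apply: low_lt_vposB => // _; rewrite low_vec ltrDl.
case: psi_y => [[b b0 ->]|[k ->]] /=; last first.
  rewrite addrK opprK ext_pos_vpos//.
  by apply: vposD => //; apply: vpos_vec.
(* For [psi b] in [B], the positive [g0 - psi b] is big and dominates [a]; otherwise the first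
   component is not big and the vector decides. *)
rewrite subr0 -addrA; have [Bb|nBb] := pselect (B (psi b)).
  have [bd pd] := g0B_gt Bb; have [] := bigD_small bd sa.
  by rewrite addrC => bs _ ps; rewrite ext_pos_big// ps.
rewrite ext_pos_vpos// smallD//; apply: small_succB => //.
by apply: succ_nB => //; apply: Psi_psi.
Qed.

Lemma ext_H_asymptotic : H_asymptotic_couple ext_psi.
Proof.
split; last exact: ext_H_type.
split=> [|x r _ r0|x y x0 y0 x_gt0]; last 2 first.
- exact: ext_AC2.
- exact: ext_AC3.
apply: AC1_of_H_type; last exact: ext_H_type.
- by move=> x; rewrite -[- x]/(x *~ -1) ext_AC2.
- by move=> x _; rewrite -[x + x]/(x *~ 2) ext_AC2.
Qed.

(** * Embedding, integration, divisibility and the successor orbit *)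

Lemma ext_embedding : ac_embedding psi ext_psi ext_inj.
Proof.
split=> [a b|a b|a _]; last by rewrite ext_psi_inj.
  by rewrite /ext_inj; congr pair; rewrite addr0.
exact: ext_inj_le.
Qed.

Lemma ext_integration : asymptotic_integration ext_psi.
Proof.
apply/seteqP; split=> // -[c u] _ /=.
have [ic0 icE] := integralP Hpsi Ipsi c.
have [Bc|nBc] := pselect (B (s c)).
  (* An element with big first component has its value in [G], so [u] is kept unchanged. *)
  have bi : big (integral psi c) by rewrite /big ic0; apply/asboolP.
  exists (integral psi c, u) => /=; first by apply: contra ic0 => /eqP[->].
  by rewrite ext_psi_big//; congr pair; rewrite /= ?addr0.
have [->|u0] := eqVneq u 0.
  exists (ext_inj (integral psi c)); first by apply: contra ic0 => /eqP[->].
  by rewrite /= ext_psi_inj; congr pair; rewrite /= ?addr0.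
(* The integral should have value [ext_beta (low u + 1)]; subtracting this from [(c, u)] gives the
   candidate [(c - g0, u + << low u + 1 >>)], whose leading index is still [low u]. *)
have lu : low (u + << low u + 1 >>) = low u by rewrite low_addvec// ltrDl.
have v0 : u + << low u + 1 >> != 0.
  have [u1 _] := lowP u0; apply/eqP => /malgP/(_ (low u)).
  by rewrite mcoeffD mcoeff_vec gt_eqF ?ltrDl// addr0 mcoeff0; apply/eqP.
have := addrK << low u + 1 >> u.
move: (u + _) lu v0 => w lw w0 wu; exists (c - g0, w); first exact: ext_neq0.
rewrite /= ext_psi_small//; last exact: small_succB.
by rewrite lw; congr pair; rewrite /= ?subrK.
Qed.

Lemma ext_divisible : divisible G -> divisible ext.
Proof.
move=> Gdiv n [a v] n0; have [b bE] := Gdiv n a n0.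
exists (b, n%:R^-1 *: v).
have En m (x : ext) : x *+ m = (x.1 *+ m, x.2 *+ m).
  by elim: m => [//|m IHm]; rewrite !mulrS IHm.
rewrite En /= bE; congr pair.
by rewrite -scaler_nat scalerA mulfV ?scale1r// pnatr_eq0 -lt0n.
Qed.

Lemma ext_beta_Psi k : Psi_set ext_psi (ext_beta k).
Proof.
have v0 := vpos_neq0 (vpos_vec (k - 1)).
exists (0, << k - 1 >>); first exact: ext_neq0.
by rewrite ext_psi_small ?big0// low_vec subrK.
Qed.

Lemma ext_cut_orbit : cut_orbit B ext_inj ext_psi ext_beta.
Proof.
move=> k; split.
- by move=> _ _ [b Bb <-] ->; apply: ext_inj_lt_beta.
- move=> _ _ -> [g gB <-]; rewrite ext_ltE sub0r opprK /=.
  (* If [s g] is in [B], then [g - g0] has the sign of the integral [g - s g], positive because [g]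
     is above [B]. *)
  have [Bg|nBg] := pselect (B (s g)); last first.
    by rewrite ext_pos_vpos ?vpos_vec//; apply: small_succB.
  have [bd _ pd] := big_succB Bg g0_succ; rewrite ext_pos_big// pd.
  have [ig0 igE] := integralP Hpsi Ipsi g.
  rewrite -[integral _ _](addrK (s g)) igE oz_subr_gt0.
  exact: gB.
have kS j : j <= k -> (k + 1 == j) = false.
  by move=> jk; rewrite gt_eqF// (le_lt_trans jk)// ltrDl.
have ck : (<< k + 1 >> - << k >>)@_k = -1 :> rat.
  by rewrite mcoeffB !mcoeff_vec eqxx kS// sub0r.
have v0 : (<< k + 1 >> - << k >> : {malg rat[int]}) != 0.
  by apply/eqP => v0; move: ck; rewrite v0 mcoeff0.
have lv : low (<< k + 1 >> - << k >>) = k.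
  apply: low_eq => [|j jk]; first by rewrite ck.
  by rewrite mcoeffB !mcoeff_vec kS ?ltW// gt_eqF// subrr.
(* This is [beta_k - beta_(k + 1)]; its leading index [k] gives it value [beta_(k + 1)], so it is
   the integral of [beta_k]. *)
pose x : ext := (0, << k + 1 >> - << k >>).
have x0 : x != 0 by apply: ext_neq0.
have px : ext_psi x = ext_beta (k + 1).
  by rewrite /x ext_psi_small ?big0// lv.
have -> : ext_beta k = x + ext_psi x.
  rewrite px; congr pair; rewrite /= ?add0r//.
  by rewrite addrAC subrr add0r.
by rewrite succ_deriv//; exact: ext_H_asymptotic.
Qed.

(** * The unique embedding into a target couple *)

Section UniversalProperty.
Variables (Gs : orderedZmodType) (psis : Gs -> Gs) (i : G -> Gs).
Variable betas : int -> Gs.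
Hypothesis Hpsis : H_asymptotic_couple psis.
Hypothesis Gsdiv : divisible Gs.
Hypothesis Ipsis : asymptotic_integration psis.
Hypothesis Hi : ac_embedding psi psis i.
Hypothesis betas_Psi : forall k, Psi_set psis (betas k).
Hypothesis betas_cut : cut_orbit B i psis betas.

Let iA : {additive G -> Gs} := additive_of_morphD (ac_embeddingD Hi).

Lemma emb0 : i 0 = 0. Proof. exact: (raddf0 iA). Qed.

Lemma emb_lt a b : (i a < i b) = (a < b).
Proof. by rewrite !oz_ltNge (ac_embedding_le Hi). Qed.

Lemma emb_neq0 a : a != 0 -> i a != 0.
Proof.
move=> /oz_gt0_or/orP[|]; rewrite -emb_lt emb0 => h; first by rewrite gt_eqF.
by rewrite -oppr_eq0 -(raddfN iA) gt_eqF.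
Qed.

Lemma emb_succ a : succ_fun psis (i a) = i (s a).
Proof.
have [ia0 {1}<-] := integralP Hpsi Ipsi a.
by rewrite (ac_embeddingD Hi) (ac_embedding_psi Hi)// succ_deriv// emb_neq0.
Qed.

Lemma betas_succ k : succ_fun psis (betas k) = betas (k + 1).
Proof. by case: (betas_cut k). Qed.

Lemma emb_lt_betas b k : B b -> i b < betas k.
Proof.
by move=> Bb; case: (betas_cut k) => h _ _; apply: h => //; exists b.
Qed.

Lemma betas_lt_emb p k : Psi_set psi p -> ~ B p -> betas k < i p.
Proof.
move=> Pp nBp; case: (betas_cut k) => _ h _; apply: h => //; exists p => //.
by move=> b; apply: nB_gt.
Qed.

Lemma betas_lt k l : k < l -> betas k < betas l.
Proof.
have lt1 m : betas m < betas (m + 1) by rewrite -betas_succ lt_succ_Psi.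
move=> kl; have [n ->] : exists n : nat, l = k + n.+1%:Z.
  case E : (l - k) (kl) => [[|n]|n]; rewrite -subr_gt0 E// => _.
  by exists n; rewrite -E addrC subrK.
elim: n => [|n IHn]; first exact: lt1.
apply: lt_trans IHn _; rewrite (_ : n.+2%:Z = n.+1%:Z + 1) ?addrA//.
by rewrite -addn1 PoszD.
Qed.

Definition eps k := i g0 - betas k.

(** The successor identity in the target applies to [betas k] and [i g0], since [s g0] is outside
    [B] and so [betas (k + 1) < i (s g0)]. *)
Lemma epsP k : [/\ eps k != 0, psis (eps k) = betas (k + 1) & 0 < eps k].
Proof.
have lt : succ_fun psis (betas k) < succ_fun psis (i g0).
  rewrite betas_succ emb_succ; apply: betas_lt_emb => //.
  exact: Psi_succ.
have [n0 p pos] := psiB_succ Hpsis Ipsis lt.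
rewrite /eps -opprB oppr_eq0 (psiN Hpsis) p betas_succ oz_gt0N// pos.
split=> //; rewrite -oz_leNgt ltW//; exact: integral_Psi_lt0.
Qed.

Definition vec_map v : Gs := \sum_(k <- msupp v) qscale v@_k (eps k).

Lemma vec_mapE v (D : {fset int}) : (msupp v `<=` D)%fset ->
  vec_map v = \sum_(k <- D) qscale v@_k (eps k).
Proof.
move=> vD; apply: big_fset_incl => // k _ kv.
by rewrite mcoeff_outdom ?qscale0.
Qed.

Lemma vec_mapD : {morph vec_map : v w / v + w}.
Proof.
move=> v w; rewrite (vec_mapE (msuppD_le v w)).
rewrite (vec_mapE (fsubsetUl (msupp v) (msupp w))).
rewrite (vec_mapE (fsubsetUr (msupp v) (msupp w))) -big_split.
by apply: eq_bigr => k _; rewrite mcoeffD qscaleDl.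
Qed.

Let vA : {additive _ -> _} := additive_of_morphD vec_mapD.

Lemma vec_map0 : vec_map 0 = 0. Proof. exact: (raddf0 vA). Qed.

Lemma vec_mapN v : vec_map (- v) = - vec_map v. Proof. exact: (raddfN vA). Qed.

Lemma vec_map_vec k : vec_map << k >> = eps k.
Proof.
by rewrite (vec_mapE msuppU_le) big_seq_fset1 mcoeffUU qscale1.
Qed.

(** The value [betas (k + 1)] of [eps k] increases strictly with [k], so the term of lowest index
    dominates the sum. *)
Lemma vec_map_low v : v != 0 ->
  [/\ vec_map v != 0, psis (vec_map v) = betas (low v + 1)
    & (0 < vec_map v) = vpos v].
Proof.
move=> v0; have [vm vj] := lowP v0; set m := low v in vm vj *.
have [e0 pe e_gt0] := epsP m.
rewrite /vec_map (big_fsetD1 m) ?mcoeff_neq0//= -?mcoeff_neq0//.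
have q0 := qscale_neq0 Gsdiv vm e0; have pq := psi_qscale Gsdiv Hpsis vm e0.
rewrite -pe -pq /vpos -/m -(qscale_gt0E Gsdiv vm e_gt0).
apply: (psi_negligible Hpsis q0); rewrite big_seq.
elim/big_ind: _ => [|x y|k]; first by rewrite /negligible eqxx.
  exact: negligibleD.
rewrite !inE => /andP[km]; rewrite -mcoeff_neq0 => vk.
have [k0 pk _] := epsP k.
rewrite /negligible (psi_qscale Gsdiv Hpsis vk k0) pq pe pk orbC betas_lt//.
rewrite ltrD2r lt_neqAle eq_sym km leNgt /=; apply/negP => /vj/eqP.
by rewrite (negPf vk).
Qed.

Definition ext_map (x : ext) : Gs := i x.1 + vec_map x.2.

Lemma ext_mapD : {morph ext_map : x y / x + y}.
Proof.
move=> [a v] [b w].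
by rewrite /ext_map /= (ac_embeddingD Hi) vec_mapD addrACA.
Qed.

Lemma ext_map_inj a : ext_map (ext_inj a) = i a.
Proof. by rewrite /ext_map vec_map0 addr0. Qed.

Lemma ext_map_beta k : ext_map (ext_beta k) = betas k.
Proof.
by rewrite /ext_map vec_mapN /= vec_map_vec /eps opprB addrC subrK.
Qed.

Lemma negligible_emb_vec a v : big a -> negligible psis (i a) (vec_map v).
Proof.
move=> /andP[a0 /asboolP Ba]; rewrite /negligible.
have [->|v0] := eqVneq v 0; first by rewrite vec_map0 eqxx.
have [_ -> _] := vec_map_low v0.
by rewrite -(ac_embedding_psi Hi)// emb_lt_betas ?orbT.
Qed.

Lemma negligible_vec_emb a v : ~~ big a -> v != 0 ->
  negligible psis (vec_map v) (i a).
Proof.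
move=> sa v0; rewrite /negligible; have [->|a0] := eqVneq a 0.
  by rewrite emb0 eqxx.
have [_ -> _] := vec_map_low v0; rewrite -(ac_embedding_psi Hi)// orbC.
by rewrite betas_lt_emb//; [exact: Psi_psi|exact: small_psi].
Qed.

(** In each case of [ext_pos], the image of the dominant term still dominates in the target. *)
Lemma ext_map_gt0 (x : ext) : 0 < x -> 0 < ext_map x.
Proof.
rewrite ext_gt0E; case: x => a v; rewrite /ext_map /=.
have [ba|sa] := boolP (big a).
  have /andP[a0 _] := ba; rewrite ext_pos_big// -emb_lt emb0.
  have nv := negligible_emb_vec v ba.
  by have [_ _ ->] := psi_negligible Hpsis (emb_neq0 a0) nv.
have [->|v0] := eqVneq v 0.
  by rewrite ext_pos0 vec_map0 addr0 -emb_lt emb0.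
have [n0 _ pos] := vec_map_low v0; rewrite ext_pos_small// addrC.
have [_ _ ->] := psi_negligible Hpsis n0 (negligible_vec_emb sa v0).
by rewrite pos.
Qed.

Lemma ext_map_psi (x : ext) : x != 0 -> ext_map (ext_psi x) = psis (ext_map x).
Proof.
case: x => a v x0; rewrite [in RHS]/ext_map /=; have [ba|sa] := boolP (big a).
  have /andP[a0 _] := ba.
  rewrite ext_psi_big// ext_map_inj (ac_embedding_psi Hi)//.
  have nv := negligible_emb_vec v ba.
  by have [_ -> _] := psi_negligible Hpsis (emb_neq0 a0) nv.
have [v0|v0] := eqVneq v 0.
  rewrite v0 ext_psi_inj ext_map_inj vec_map0 addr0 (ac_embedding_psi Hi)//.
  by apply: contraNneq x0 => ->; rewrite v0.
have [n0 p _] := vec_map_low v0.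
rewrite ext_psi_small// ext_map_beta [i a + _]addrC.
by have [_ -> _] := psi_negligible Hpsis n0 (negligible_vec_emb sa v0).
Qed.

Lemma ext_map_lt (x y : ext) : x < y -> ext_map x < ext_map y.
Proof.
rewrite -oz_subr_gt0 => /ext_map_gt0.
by rewrite (morphD_zmod ext_mapD) oz_subr_gt0.
Qed.

Lemma ext_map_embedding : ac_embedding ext_psi psis ext_map.
Proof.
split=> [|x y|x x0]; [exact: ext_mapD| |exact: ext_map_psi].
have [|] := boolP (x <= y).
  by rewrite le_eqVlt => /orP[/eqP->|/ext_map_lt/ltW->//]; rewrite lexx.
by rewrite -oz_ltNge => /ext_map_lt; rewrite oz_ltNge => /negbTE.
Qed.

(** Additivity fixes [h] on [e_k = g0 - beta_k], and torsion-freeness of the target then fixes it on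
    rational multiples of [e_k]. *)
Lemma ext_map_uniq (h : ext -> Gs) : ac_embedding ext_psi psis h ->
  (forall a, h (ext_inj a) = i a) -> (forall k, h (ext_beta k) = betas k) ->
  ext_map = h.
Proof.
move=> Hh hi hb.
have gD : {morph (fun v => h (0, v)) : v w / v + w}.
  move=> v w; rewrite -(ac_embeddingD Hh); congr (h (_, _)).
  by rewrite /= addr0.
pose g : {additive {malg rat[int]} -> Gs} := additive_of_morphD gD.
have g_vec k : g << k >> = eps k.
  have E : (0, << k >>) = ext_inj g0 - ext_beta k :> ext.
    by congr pair; rewrite /= ?subrr// sub0r opprK.
  by rewrite /= E (morphD_zmod (ac_embeddingD Hh)) hi hb.
apply/funext => -[a v].
have -> : (a, v) = ext_inj a + (0, v) :> ext.
  by congr pair; rewrite ?addr0 ?add0r.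
rewrite ext_mapD (ac_embeddingD Hh) ext_map_inj hi; congr (_ + _).
rewrite /ext_map /= emb0 add0r -[h _]/(g v) {2}[v]monalgE raddf_sum.
apply: eq_bigr => k _; rewrite -g_vec; apply/esym/(additive_qscale Gsdiv).
by apply: mkmalgU_mulz; rewrite -numqE.
Qed.

End UniversalProperty.
End Extension.

Theorem lemma4p12 (G : orderedZmodType) (psi : G -> G) (B : set G)
  (Hpsi : H_asymptotic_couple psi)
  (Ipsi : asymptotic_integration psi)
  (Gdiv : divisible G)
  (Bne : B !=set0)
  (BPsi : B `<=` Psi_set psi)
  (Bdown : downward_closed_in (Psi_set psi) B)
  (Bsucc : succ_fun psi @` B `<=` B)
  (BnPsi : B <> Psi_set psi) :
  exists (GB : orderedZmodType) (psiB : GB -> GB) (j : G -> GB)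
         (beta : int -> GB),
    [/\ H_asymptotic_couple psiB, divisible GB, ac_embedding psi psiB j
      & forall k, Psi_set psiB (beta k)] /\
    [/\ asymptotic_integration psiB,
        cut_orbit B j psiB beta
      & forall (Gs : orderedZmodType) (psis : Gs -> Gs) (i : G -> Gs)
               (betas : int -> Gs),
          H_asymptotic_couple psis -> divisible Gs ->
          asymptotic_integration psis ->
          ac_embedding psi psis i ->
          (forall k, Psi_set psis (betas k)) ->
          cut_orbit B i psis betas ->
          exists! h : GB -> Gs,
            [/\ ac_embedding psiB psis h,
                forall g, h (j g) = i g
              & forall k, h (beta k) = betas k]].
Proof.
have [x x0 nBx] : exists2 x, x != 0 & ~ B (psi x).
  apply: contra_notP BnPsi => h; apply/seteqP; split=> // _ [x x0 <-].
  by apply: contra_notP h => nBx; exists x.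
(* The integral of this element is [x], so its successor is [psi x], outside [B]. *)
pose g0 := x + psi x.
have g0_succ : ~ B (succ_fun psi g0) by rewrite succ_deriv.
exists (ext Hpsi Bdown), (ext_psi g0 (Bdown := Bdown)).
exists (ext_inj Hpsi Bdown), (ext_beta g0 Hpsi Bdown); split.
  split; first exact: ext_H_asymptotic.
  - exact: ext_divisible.
  - exact: ext_embedding.
  - exact: ext_beta_Psi.
split; first exact: ext_integration.
  exact: ext_cut_orbit.
move=> Gs psis i betas Hpsis Gsdiv Ipsis Hi betas_Psi betas_cut.
exists (ext_map g0 i betas); split.
  split; first exact: ext_map_embedding.
  - exact: ext_map_inj.
  - exact: ext_map_beta.
by move=> h [Hh hi hb]; apply: (ext_map_uniq Gsdiv Hi Hh).
Qed.
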